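(* Let $\mathbf{l},\mathbf{h}\in\mathbb{R}^d$ with $l_i\le h_i$ for every $i$, and define $\mathbf{m}:=(\mathbf{l}+\mathbf{h})/2$ and $\mathbf{r}:=(\mathbf{h}-\mathbf{l})/2$. Let $c\in(0,1]$ and suppose $\|\mathbf{r}\|_2<c\|\mathbf{m}\|_2$. Set $$\alpha:=\frac{c\bigl(\|\mathbf{m}\|_2^2-\|\mathbf{r}\|_2^2\bigr)}{\|\mathbf{m}\|_2\bigl(c\|\mathbf{m}\|_2-\|\mathbf{r}\|_2\bigr)}.$$ Then every $\boldsymbol{\xi}\in[\mathbf{l},\mathbf{h}]$ satisfies $$\langle\alpha\mathbf{m},\mathbf{y}\rangle\ge\langle\boldsymbol{\xi},\mathbf{y}\rangle\qquad\text{for all }\mathbf{y}\in\mathcal{C}(\boldsymbol{\xi},c).$$ Moreover, for $d\ge2$, $\alpha$ is the exact minimum for the containing ball $\mathbb{B}(\mathbf{m},\|\mathbf{r}\|_2)$, that is, $\alpha$ is the smallest $\alpha'>0$ such that $\langle\alpha'\mathbf{m},\mathbf{y}\rangle\ge\langle\mathbf{x},\mathbf{y}\rangle$ for all $\mathbf{x}\in\mathbb{B}(\mathbf{m},\|\mathbf{r}\|_2)$ and all $\mathbf{y}\in\mathcal{C}(\mathbf{x},c)$. For $d=1$, $\alpha$ remains a valid sufficient scaling, i.e. $\alpha'=\alpha$ satisfies this same condition for $\mathbb{B}(\mathbf{m},\|\mathbf{r}\|_2)$.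
   Context: $[\mathbf{l},\mathbf{h}]:=\{\boldsymbol{\xi}\in\mathbb{R}^d: l_i\le\xi_i\le h_i,\ i=1,\dots,d\}$. $\mathbb{B}(\mathbf{m},R):=\{\mathbf{x}\in\mathbb{R}^d:\|\mathbf{x}-\mathbf{m}\|_2\le R\}$. For $\mathbf{x}\ne0$ and $c\in(0,1]$, $\mathcal{C}(\mathbf{x},c):=\{\mathbf{y}\in\mathbb{R}^d:\langle\mathbf{x},\mathbf{y}\rangle\ge c\|\mathbf{x}\|_2\|\mathbf{y}\|_2\}$. (Under the hypotheses neither the box nor the ball contains the origin.) *)

(* Defs.v *)
From mathcomp Require Export all_boot all_order all_algebra.
From mathcomp Require Export classical_sets reals.

Set Implicit Arguments.
Unset Strict Implicit.
Unset Printing Implicit Defensive.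

Export Order.TTheory GRing.Theory Num.Theory.
Local Open Scope classical_set_scope.
Local Open Scope ring_scope.

Section Euclidean.
Variables (R : realType) (d : nat).
Implicit Types (x y m l h : 'rV[R]_d) (c rho : R) (X : set 'rV[R]_d).

Definition dot x y : R := \sum_(i < d) x 0 i * y 0 i.

(* The norm `|x| on row vectors in MathComp-Analysis is the sup norm, not
   this one. *)
Definition norm2 x : R := Num.sqrt (dot x x).

Definition box l h : set 'rV[R]_d :=
  [set x | forall i, l 0 i <= x 0 i <= h 0 i].

Definition ball2 m rho : set 'rV[R]_d := [set x | norm2 (x - m) <= rho].

(* Only meaningful for x != 0. *)
Definition cone x c : set 'rV[R]_d :=
  [set y | c * norm2 x * norm2 y <= dot x y].

Definition valid_scalings m c X : set R :=
  [set a | 0 < a /\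
    forall x, X x -> forall y, cone x c y -> dot x y <= dot (a *: m) y].

End Euclidean.

Definition is_least (R : realType) (A : set R) (a : R) : Prop :=
  A a /\ lbound A a.

(* Main.v *)
(** Write [M], [rho] for the norms of [m], [r], and put [s = sqrt (1 - c^2)].
    For fixed [x] at angle [theta] from [m], the worst [y] in the cone makes the
    angle [theta + arccos c] with [m], so that [a] is a valid scaling for [x]
    iff, with [x = (x1, x2)] in the plane of [x] and [m] ([m] on the first axis),
    [c (x1^2 + x2^2) <= a M (c x1 - s |x2|)].
    This is an intersection of two discs through the origin of diameter
    [a M / c], and the ball of radius [rho] around [m] lies in them iff
    [a >= alpha], by comparing the distance of the centers to the radii. The
    point where ball and disc touch yields minimality when [2 <= d]. *)
Require Import Defs.
From mathcomp Require Import ring lra.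

Set Implicit Arguments.
Unset Strict Implicit.
Unset Printing Implicit Defensive.

Local Open Scope classical_set_scope.
Local Open Scope ring_scope.

(** * Euclidean geometry of row vectors *)

Section Dot.
Variables (R : realType) (d : nat).
Implicit Types (x y z : 'rV[R]_d) (a b c rho : R).

Lemma dotC x y : dot x y = dot y x.
Proof. by apply: eq_bigr => i _; rewrite mulrC. Qed.

Lemma dotDl x y z : dot (x + y) z = dot x z + dot y z.
Proof. by rewrite -big_split; apply: eq_bigr => i _; rewrite mxE mulrDl. Qed.

Lemma dotZl a x y : dot (a *: x) y = a * dot x y.
Proof. by rewrite mulr_sumr; apply: eq_bigr => i _; rewrite mxE mulrA. Qed.

Lemma dot0l x : dot 0 x = 0.
Proof. by rewrite -[0 in LHS](scale0r (0 : 'rV[R]_d)) dotZl mul0r. Qed.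

Lemma dotDr x y z : dot z (x + y) = dot z x + dot z y.
Proof. by rewrite dotC dotDl !(dotC z). Qed.

Lemma dotZr a x y : dot x (a *: y) = a * dot x y.
Proof. by rewrite dotC dotZl dotC. Qed.

Lemma dotBl x y z : dot (x - y) z = dot x z - dot y z.
Proof. by rewrite dotDl -scaleN1r dotZl mulN1r. Qed.

Lemma dotBr x y z : dot z (x - y) = dot z x - dot z y.
Proof. by rewrite dotC dotBl !(dotC z). Qed.

Lemma dot_delta x i : dot x (delta_mx 0 i) = x 0 i.
Proof.
rewrite /dot (bigD1 i) //= mxE !eqxx mulr1 big1 ?addr0 // => j ji.
by rewrite mxE (negbTE ji) andbF mulr0.
Qed.

Lemma dot_ge0 x : 0 <= dot x x.
Proof. by apply: sumr_ge0 => i _; rewrite -expr2 sqr_ge0. Qed.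

Lemma norm2_ge0 x : 0 <= norm2 x.
Proof. exact: sqrtr_ge0. Qed.

Lemma sqr_norm2 x : norm2 x ^+ 2 = dot x x.
Proof. by rewrite sqr_sqrtr // dot_ge0. Qed.

Lemma norm2_le x a : 0 <= a -> (norm2 x <= a) = (dot x x <= a ^+ 2).
Proof. by move=> a0; rewrite -sqr_norm2 ler_sqr // nnegrE norm2_ge0. Qed.

Lemma norm2Z a x : norm2 (a *: x) = `|a| * norm2 x.
Proof.
by rewrite /norm2 dotZl dotZr mulrA -expr2 sqrtrM ?sqr_ge0 // sqrtr_sqr.
Qed.

Lemma dot_eq0 x : (dot x x == 0) = (x == 0).
Proof.
apply/idP/eqP => [|->]; last by rewrite dot0l.
rewrite psumr_eq0 => [/allP x0|i _]; last by rewrite -expr2 sqr_ge0.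
apply/rowP => i; rewrite mxE; apply/eqP.
by have := x0 i (mem_index_enum _); rewrite /= mulf_eq0 orbb.
Qed.

Lemma cauchy_schwarz x y : dot x y ^+ 2 <= dot x x * dot y y.
Proof.
have [/eqP|x0] := eqVneq (dot x x) 0.
  rewrite dot_eq0 => /eqP ->.
  by rewrite !dot0l mul0r expr0n.
have {}x0 : 0 < dot x x by rewrite lt_neqAle eq_sym x0 dot_ge0.
have := dot_ge0 (dot x x *: y - dot x y *: x).
rewrite !(dotBl, dotBr, dotZl, dotZr) (dotC y x) => H.
by rewrite -subr_ge0 -(pmulr_rge0 _ x0); apply: le_trans H _; lra.
Qed.

(* Cauchy-Schwarz for the components of [y] and [z] orthogonal to [x]. *)
Lemma gram_le x y z :
  (dot x x * dot y z - dot x y * dot x z) ^+ 2 <=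
  (dot x x * dot y y - dot x y ^+ 2) * (dot x x * dot z z - dot x z ^+ 2).
Proof.
have [/eqP|x0] := eqVneq (dot x x) 0.
  rewrite dot_eq0 => /eqP ->.
  by rewrite !dot0l !mul0r subrr !expr0n /= subrr mul0r.
have {}x0 : 0 < dot x x by rewrite lt_neqAle eq_sym x0 dot_ge0.
have := cauchy_schwarz (dot x x *: y - dot x y *: x)
                       (dot x x *: z - dot x z *: x).
rewrite !(dotBl, dotBr, dotZl, dotZr) (dotC y x) (dotC z x) => H.
rewrite -(ler_pM2l (exprn_gt0 2 x0)); lra.
Qed.

(** Supplies the second axis of the plane in which the extremal point for minimality is built; in
    dimension one there is no such axis. *)
Lemma exists_orthogonal x : (2 <= d)%N -> x != 0 ->
  exists2 w, dot x w = 0 & norm2 w = norm2 x.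
Proof.
move=> d2 x0.
have [i xi0] : exists i, x 0 i != 0.
  apply/existsP; apply: contraNT x0; rewrite negb_exists => /forallP H.
  by apply/eqP/rowP => i; rewrite mxE; apply/eqP/negPn.
have [j ji] : exists j : 'I_d, j != i.
  apply/existsP; apply: contraTT d2; rewrite negb_exists => /forallP H.
  rewrite -leqNgt -[leqLHS]card_ord -(card1 i).
  by apply/subset_leq_card/fintype.subsetP => k _; rewrite inE; apply/negPn.
pose w : 'rV[R]_d := x 0 i *: delta_mx 0 j - x 0 j *: delta_mx 0 i.
have xw : dot x w = 0 by rewrite dotBr !dotZr !dot_delta mulrC subrr.
have w0 : norm2 w != 0.
  rewrite -sqrf_eq0 sqr_norm2 dot_eq0; apply/eqP => /rowP /(_ j).
  rewrite !mxE !eqxx (negbTE ji) /= mulr1 mulr0 subr0 => xi.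
  by rewrite xi eqxx in xi0.
exists ((norm2 x / norm2 w) *: w); first by rewrite dotZr xw mulr0.
by rewrite norm2Z ger0_norm ?divr_ge0 ?norm2_ge0 // divfK.
Qed.

End Dot.

(** * Scalings valid on a ball, and their minimum *)

Section Scaling.
Variables (R : realType).
Implicit Types (a b c s rho M : R).

(** With [K = M ^+ 2 - rho ^+ 2] and [g = c * M - rho], the conclusion describes the disc of center
    [K / (2 * g)] times [(c, - s)] and radius [K / (2 * g)]. Its center is at distance [N / (2 * g)]
    from [(M, 0)], and [N + 2 * g * rho = K], so the small disc touches it from inside. *)
Lemma disc_inclusion a b c s rho M :
  0 <= rho -> rho < c * M -> c <= 1 -> 0 < M -> s ^+ 2 = 1 - c ^+ 2 ->
  (a - M) ^+ 2 + b ^+ 2 <= rho ^+ 2 ->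
  (c * M - rho) * (a ^+ 2 + b ^+ 2) <= (M ^+ 2 - rho ^+ 2) * (c * a - s * b).
Proof.
move=> rho0 rcM c1 M0 sE ab.
pose u := c * M ^+ 2 + c * rho ^+ 2 - 2 * M * rho.
pose v := s * (M ^+ 2 - rho ^+ 2).
pose N := M ^+ 2 + rho ^+ 2 - 2 * c * rho * M.
(* [(u, v)] is, up to a factor, the vector from the center of the disc to [m]. *)
have uvN : u ^+ 2 + v ^+ 2 = N ^+ 2 by rewrite /v exprMn sE /u /N; ring.
have N0 : 0 <= N.
  have := mulr_ge0 (mulr_ge0 rho0 (ltW M0)) (_ : 0 <= 1 - c).
  rewrite subr_ge0 => /(_ c1); have := sqr_ge0 (M - rho); rewrite /N; nra.
have uv : u * (a - M) + v * b <= N * rho.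
  apply: le_trans (ler_norm _) _; rewrite -ler_sqr ?nnegrE ?mulr_ge0 //.
  rewrite real_normK ?num_real // exprMn -uvN.
  have := ler_wpM2l (addr_ge0 (sqr_ge0 u) (sqr_ge0 v)) ab.
  have := sqr_ge0 (u * b - v * (a - M)); nra.
have g0 : 0 <= c * M - rho by rewrite subr_ge0 ltW.
(* Expanded around [(M, 0)], the difference of the two sides is exactly controlled by the sum of
   these two bounds. *)
have := ler_wpM2l g0 ab; move: uv; rewrite /u /v /N; nra.
Qed.

Variables (d : nat) (m : 'rV[R]_d) (c rho : R).
Local Notation M := (norm2 m).
Let alpha := c * (M ^+ 2 - rho ^+ 2) / (M * (c * M - rho)).
Hypotheses (rho0 : 0 <= rho) (c0 : 0 < c) (c1 : c <= 1)
  (rho_lt : rho < c * M).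

Let M0 : 0 < M.
Proof. by rewrite -(pmulr_rgt0 _ c0) (le_lt_trans rho0). Qed.

Let rhoM : rho < M.
Proof. by apply: lt_le_trans rho_lt _; rewrite ler_piMl // ltW. Qed.

Let sqr_rhoM : 0 < M ^+ 2 - rho ^+ 2.
Proof. by rewrite subr_gt0 ltr_sqr ?nnegrE // ltW. Qed.

Let den0 : 0 < M * (c * M - rho).
Proof. by rewrite mulr_gt0 // subr_gt0. Qed.

Let s := Num.sqrt (1 - c ^+ 2).

Let s0 : 0 <= s. Proof. exact: sqrtr_ge0. Qed.

Let sE : s ^+ 2 = 1 - c ^+ 2.
Proof. by rewrite sqr_sqrtr // subr_ge0 expr_le1 // ltW. Qed.

Lemma valid_scalings_ball : valid_scalings m c (ball2 m rho) alpha.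
Proof.
split; first by rewrite divr_gt0 // mulr_gt0.
move=> x; rewrite /ball2 /= norm2_le // => xm y; rewrite /cone /= => xy.
have ME : M ^+ 2 = dot m m by apply: sqr_norm2.
have X0 : 0 < dot x x.
  rewrite lt_neqAle dot_ge0 andbT eq_sym dot_eq0; apply/eqP => x0.
  move: xm; rewrite x0 -scaleN1r add0r dotZl dotZr mulrA mulrNN !mul1r -ME.
  by rewrite -subr_le0 leNgt sqr_rhoM.
have t0 : 0 <= dot x y.
  by apply: le_trans xy; rewrite !mulr_ge0 ?norm2_ge0 // ltW.
rewrite !(dotBl, dotBr) (dotC m x) in xm.
(* [q / M] is the length of the component of [x] orthogonal to [m]. *)
pose q := Num.sqrt (dot x x * dot m m - dot x m ^+ 2).
have q0 : 0 <= q by apply: sqrtr_ge0.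
have qE : q ^+ 2 = dot x x * dot m m - dot x m ^+ 2.
  by rewrite sqr_sqrtr // subr_ge0 cauchy_schwarz.
have disc : (c * M - rho) * M * dot x x <=
            (M ^+ 2 - rho ^+ 2) * (c * dot x m - s * q).
  have Mn0 : M != 0 by rewrite gt_eqF.
  have XE : dot x x = (dot x m / M) ^+ 2 + (q / M) ^+ 2.
    by rewrite !expr_div_n qE ME; field; rewrite -ME expf_neq0.
  have /(disc_inclusion rho0 rho_lt c1 M0 sE) :
      (dot x m / M - M) ^+ 2 + (q / M) ^+ 2 <= rho ^+ 2.
    apply: le_trans xm; rewrite -ME sqrrB addrAC -addrA addrCA XE.
    rewrite le_eqVlt; apply/orP; left; apply/eqP.
    by field.
  rewrite -XE => /(ler_wpM2r (ltW M0)) H.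
  have -> : c * dot x m - s * q = (c * (dot x m / M) - s * (q / M)) * M.
    by field.
  lra.
(* Addition of angles without trigonometry: [gram_le] bounds the bracket by [q] times the root of
   [dot x x * dot y y - dot x y ^+ 2], and the squared cone condition bounds [c] times that root by
   [s * dot x y]. *)
have angle : c * (dot x m * dot x y - dot x x * dot m y) <= q * s * dot x y.
  apply: le_trans (ler_norm _) _.
  rewrite -ler_sqr ?nnegrE ?mulr_ge0 // real_normK ?num_real //.
  have cone2 : c ^+ 2 * (dot x x * dot y y - dot x y ^+ 2)
               <= s ^+ 2 * dot x y ^+ 2.
    rewrite sE; move: xy.
    rewrite -ler_sqr ?nnegrE ?mulr_ge0 ?norm2_ge0 ?(ltW c0) //.
    rewrite !exprMn !sqr_norm2; lra.
  have := ler_wpM2l (sqr_ge0 q) cone2.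
  have := ler_wpM2l (sqr_ge0 c) (gram_le x m y); rewrite -qE; lra.
rewrite dotZl mulrAC ler_pdivlMr // -(ler_pM2l X0).
(* In the sum of the two scaled inequalities the terms in [q * s] cancel. *)
have := ler_wpM2l t0 disc.
have := ler_wpM2l (ltW sqr_rhoM) angle; lra.
Qed.

(* The point [x] below is where the ball touches the disc, up to the sign of
   [w]; [y] is a boundary ray of its cone. *)
Lemma lbound_valid_scalings_ball :
  (2 <= d)%N -> lbound (valid_scalings m c (ball2 m rho)) alpha.
Proof.
move=> d2 a [_ aP].
have m0 : m != 0 by rewrite -dot_eq0 -sqr_norm2 gt_eqF // exprn_gt0.
have [w mw wm] := exists_orthogonal d2 m0.
have ww : dot w w = M ^+ 2 by rewrite -wm sqr_norm2.
have mm : dot m m = M ^+ 2 by rewrite sqr_norm2.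
pose N := M ^+ 2 + rho ^+ 2 - 2 * c * rho * M.
have N0 : 0 < N.
  have := mulr_ge0 (mulr_ge0 rho0 (ltW M0)) (_ : 0 <= 1 - c).
  rewrite subr_ge0 => /(_ c1).
  have : 0 < (M - rho) ^+ 2 by rewrite exprn_gt0 // subr_gt0.
  rewrite /N; nra.
have Nn0 : N != 0 by rewrite gt_eqF.
have Mn0 : M != 0 by rewrite gt_eqF.
pose k := (M ^+ 2 - rho ^+ 2) / (N * M).
(* In the axes of [m] and [w] this is [(M + rho * u / N, rho * v / N)], with [u] and [v] as in
   [disc_inclusion]: [m] moved by [rho] straight away from the center of the disc. *)
pose x := (k * (M - c * rho)) *: m + (k * rho * s) *: w.
(* Since [(M - c rho + i rho s) (c + i s) = (c M - rho) + i s M], this is [x] turned by arccos c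
   away from [m], up to a positive factor. *)
pose y := (c * M - rho) *: m + (s * M) *: w.
have xm : dot x m = M * (M ^+ 2 - rho ^+ 2) * (M - c * rho) / N.
  by rewrite dotDl !dotZl (dotC w) mw mm /k; field; rewrite Nn0 Mn0.
have xx : dot x x = (M ^+ 2 - rho ^+ 2) ^+ 2 / N.
  rewrite !(dotDl, dotDr, dotZl, dotZr) (dotC w m) mw mm ww.
  transitivity (k ^+ 2 * M ^+ 2 * ((M - c * rho) ^+ 2 + rho ^+ 2 * s ^+ 2)).
    ring.
  rewrite sE (_ : _ + _ = N); last by rewrite /N; ring.
  by rewrite /k; field; rewrite Nn0 Mn0.
have yy : dot y y = M ^+ 2 * N.
  rewrite !(dotDl, dotDr, dotZl, dotZr) (dotC w m) mw mm ww.
  transitivity (M ^+ 2 * ((c * M - rho) ^+ 2 + M ^+ 2 * s ^+ 2)); first ring.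
  by rewrite sE /N; ring.
have xy : dot x y = c * M * (M ^+ 2 - rho ^+ 2).
  rewrite !(dotDl, dotDr, dotZl, dotZr) (dotC w m) mw mm ww.
  transitivity (k * M ^+ 2 * ((M - c * rho) * (c * M - rho)
                              + rho * M * s ^+ 2)); first ring.
  rewrite sE (_ : _ + _ = c * N); last by rewrite /N; ring.
  by rewrite /k; field; rewrite Nn0 Mn0.
have my : dot m y = (c * M - rho) * M ^+ 2.
  by rewrite dotDr !dotZr mw mm mulr0 addr0.
have xB : ball2 m rho x.
  rewrite /ball2 /= norm2_le // !(dotBl, dotBr) (dotC m x) xm xx mm.
  rewrite le_eqVlt; apply/orP; left; apply/eqP.
  transitivity (rho ^+ 2 + (M ^+ 2 - rho ^+ 2) / N *
     (M ^+ 2 - rho ^+ 2 - 2 * M * (M - c * rho) + N)); first by field.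
  by rewrite /N; ring.
have yC : cone x c y.
  rewrite /cone /= xy -ler_sqr ?nnegrE ?mulr_ge0 ?norm2_ge0
    ?(ltW c0) ?(ltW M0) ?(ltW sqr_rhoM) //.
  rewrite !exprMn (sqr_norm2 x) (sqr_norm2 y) xx yy.
  by rewrite le_eqVlt; apply/orP; left; apply/eqP; field.
have := aP x xB y yC; rewrite dotZl xy my => H.
rewrite ler_pdivrMr // -(ler_pM2l M0); lra.
Qed.

End Scaling.

(** In each coordinate, [r_i ^+ 2 - (x_i - m_i) ^+ 2] factors as [(x_i - l_i) * (h_i - x_i)]. *)
Lemma box_sub_ball2 (R : realType) (d : nat) (l h : 'rV[R]_d) :
  box l h `<=` ball2 (2^-1 *: (l + h)) (norm2 (2^-1 *: (h - l))).
Proof.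
move=> x xB; rewrite /ball2 /= norm2_le ?norm2_ge0 // sqr_norm2.
apply: ler_sum => i _; rewrite !mxE -subr_ge0.
have /andP[] := xB i; rewrite -subr_ge0 -(subr_ge0 (x 0 i)) => lx xh.
by apply: le_trans (mulr_ge0 lx xh) _; lra.
Qed.

Theorem theorem6p1 (R : realType) (d : nat) (l h : 'rV[R]_d) (c : R)
  (m := 2^-1 *: (l + h)) (r := 2^-1 *: (h - l))
  (alpha := c * (norm2 m ^+ 2 - norm2 r ^+ 2)
            / (norm2 m * (c * norm2 m - norm2 r))) :
  (forall i, l 0 i <= h 0 i) ->
  0 < c -> c <= 1 ->
  norm2 r < c * norm2 m ->
  [/\ forall xi, box l h xi ->
        forall y, cone xi c y -> dot xi y <= dot (alpha *: m) y,
      (2 <= d)%N ->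
        is_least (valid_scalings m c (ball2 m (norm2 r))) alpha
    & d = 1%N -> valid_scalings m c (ball2 m (norm2 r)) alpha].
Proof.
move=> _ c0 c1 rm.
have valid := valid_scalings_ball (norm2_ge0 r) c0 c1 rm.
split=> [xi /box_sub_ball2 xiB|d2|//]; first exact: valid.2.
by split=> //; apply: lbound_valid_scalings_ball (norm2_ge0 r) c0 c1 rm d2.
Qed.
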